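(* Let $Y$ be a nonempty complete $\mathrm{CAT}(1)$-space with $\dim_C Y < \infty$ and diameter $\operatorname{diam} Y \le \pi/2$. Then $\operatorname{rad} Y < \pi/2$. In particular, $C(Y)$ consists of a single point.
   Context: A $\mathrm{CAT}(1)$-space is a metric space in which any two points at distance $< \pi$ are joined by a minimizing geodesic, and in which every geodesic triangle of perimeter $< 2\pi$ satisfies the $\mathrm{CAT}(1)$ comparison inequality with respect to comparison triangles in the unit sphere $\mathbb{S}^2(1)$. For a topological space $Y$, $\dim_C Y$ is the supremum of the covering dimensions of compact subsets of $Y$. For a metric space $A$ with metric $d$, $\operatorname{rad} A := \inf_{x \in A} \sup_{y \in A} d(x,y)$, and $C(A)$ is the set of all points of $A$ at which the function $A \ni x \mapsto \sup_{y \in A} d(x,y)$ attains the infimum $\operatorname{rad} A$ (the centers of $A$). *)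

(* Defs.v *)
From HB Require Import structures.
From mathcomp Require Import all_boot all_order all_algebra.
From mathcomp Require Import all_classical all_reals all_analysis.

Set Implicit Arguments.
Unset Strict Implicit.
Unset Printing Implicit Defensive.

Import Order.TTheory GRing.Theory Num.Theory.

Local Open Scope classical_set_scope.
Local Open Scope ring_scope.

(* The completeness axiom of completeType, which cannot be used directly since
   it also carries a base point. *)
Definition complete_space (T : uniformType) : Prop :=
  forall F : set_system T, ProperFilter F -> cauchy F -> exists x : T, F --> x.

(* Distances are bare functions in the next two definitions so that they apply
   both to a metricType and to the unit sphere with its angular distance.
   Geodesics are parametrized by arc length; the values of c outside
   [0, dist x y] are irrelevant. *)
Definition minimizing_geodesic (R : realType) (T : Type) (dist : T -> T -> R)
    (x y : T) (c : R -> T) : Prop :=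
  [/\ c 0 = x, c (dist x y) = y &
      forall s t : R, 0 <= s <= dist x y -> 0 <= t <= dist x y ->
        dist (c s) (c t) = `|s - t| ].

(* The i-th side joins the i-th vertex to the next one, indices modulo 3. *)
Definition geodesic_triangle (R : realType) (T : Type) (dist : T -> T -> R)
    (p : 'I_3 -> T) (c : 'I_3 -> R -> T) : Prop :=
  forall i : 'I_3, minimizing_geodesic dist (p i) (p (i + 1)) (c i).

Definition dotmul3 (R : realType) (u v : 'rV[R]_3) : R := (u *m v^T) 0 0.

Definition sphere2 (R : realType) : Type := {v : 'rV[R]_3 | dotmul3 v v == 1}.

Definition sphere_dist (R : realType) (u v : sphere2 R) : R :=
  acos (dotmul3 (val u) (val v)).

(* The comparison points of c i s and c j t are c' i s and c' j t: they lie on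
   the corresponding sides at the same distance from the initial vertices. *)
Definition CAT1 (R : realType) (T : metricType R) : Prop :=
  (forall x y : T, mdist x y < pi ->
     exists c : R -> T, minimizing_geodesic mdist x y c) /\
  (forall (p : 'I_3 -> T) (c : 'I_3 -> R -> T),
     geodesic_triangle mdist p c ->
     \sum_(i < 3) mdist (p i) (p (i + 1)) < 2 * pi ->
     forall (p' : 'I_3 -> sphere2 R) (c' : 'I_3 -> R -> sphere2 R),
     geodesic_triangle (@sphere_dist R) p' c' ->
     (forall i, sphere_dist (p' i) (p' (i + 1)) = mdist (p i) (p (i + 1))) ->
     forall (i j : 'I_3) (s t : R),
       0 <= s <= mdist (p i) (p (i + 1)) ->
       0 <= t <= mdist (p j) (p (j + 1)) ->
       mdist (c i s) (c j t) <= sphere_dist (c' i s) (c' j t)).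

Definition open_cover (X : topologicalType) (U : set (set X)) : Prop :=
  U `<=` open /\ \bigcup_(A in U) A = [set: X].

(* Every open cover has an open refinement such that each point lies in at most
   n members, i.e. the covering dimension of X is at most n - 1. *)
Definition refinement_order_le (X : topologicalType) (n : nat) : Prop :=
  forall U : set (set X), open_cover U ->
    exists V : set (set X), [/\ open_cover V,
      (forall B, V B -> exists2 A, U A & B `<=` A) &
      forall x : X, ([set B | V B /\ B x] #<= `I_n)%card].

(* This is -1 for the empty space and +oo if there is no finite bound. *)
Definition covering_dim (R : realType) (X : topologicalType) : \bar R :=
  ereal_inf [set (n%:R - 1)%:E | n in [set n | refinement_order_le X n]].

(* A compact K is seen as a space in its own right through set_type, which
   carries the induced topology. *)
Definition dimC (R : realType) (X : topologicalType) : \bar R :=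
  ereal_sup [set covering_dim R (set_type K) | K in [set K : set X | compact K]].

Definition diameter (R : realType) (A : metricType R) : \bar R :=
  ereal_sup [set (mdist xy.1 xy.2)%:E | xy in [set: A * A]].

Definition eccentricity (R : realType) (A : metricType R) (x : A) : \bar R :=
  ereal_sup [set (mdist x y)%:E | y in [set: A]].

Definition metric_radius (R : realType) (A : metricType R) : \bar R :=
  ereal_inf [set eccentricity x | x in [set: A]].

Definition centers (R : realType) (A : metricType R) : set A :=
  [set x | eccentricity x = metric_radius A].
Arguments centers {R} A.

(* Main.v *)
Require Import Defs.
From HB Require Import structures.
From mathcomp Require Import all_boot all_order all_algebra.
From mathcomp Require Import all_classical all_reals all_analysis.
From mathcomp Require Import zify ring lra.

Set Implicit Arguments.
Unset Strict Implicit.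
Unset Printing Implicit Defensive.

(** Write K(x, y) for the cosine of the distance of x and y. Since all distances
are at most pi / 2, K takes values in [0, 1], and comparing a triangle with its
spherical model turns the CAT(1) condition into a concavity property of K
([CAT1_cos_convex]): along a geodesic c of length l from p to x,
  sin l * K(c r, y) >= sin (l - r) * K(p, y) + sin r * K(x, y).
Everything geometric in the proof is a consequence of this inequality. It says
that the sets of points z with K(z, y) >= k are convex for k >= 0, and that the
midpoint m of p and x satisfies
  K(p, y) + K(x, y) <= 2 * cos (d(p, x) / 2) * K(m, y).

The midpoint inequality shows by induction that any N points y have a common z
with K(z, y) >= 2 ^- N ([few_points_cos]). This bound degenerates when N grows,
as it must: for r < pi / 2 no point of the unit sphere of a Hilbert space is at
distance at most r from all the vectors of an infinite orthonormal basis. Finite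
dimension enters through a Helly theorem ([topological_helly]): if every open
cover of a compact set has an open refinement with at most n members through
each point, and m >= n, then m + 1 closed convex sets have a common point as soon
as any m of them have one. For the sets of z with K(z, y) >= 2 ^- n it follows
that every finite family of points y, of any size, has a common z
([finite_helly_cos]).

The Helly theorem is an instance of the Knaster-Kuratowski-Mazurkiewicz
principle. Let p_i lie in every C_j with j <> i, and suppose that the C_j have
no common point. Iterated geodesic cones over p_0, ..., p_m map a cube onto a
compact set that the complements of the C_j cover. A refinement of this cover
of order at most n, together with its Lebesgue number, labels the points of a
fine grid in the cube, and the position of the p_i makes this a Sperner
labelling. A small cell with all m + 1 labels gives a point lying in m + 1
distinct members of the refinement, which contradicts m >= n. Sperner's lemma
([sperner]) is proved with chains modulo 2 on the grid, whose fundamental chain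
is built by iterated prisms.

Finally let a be the supremum of the numbers b such that every finite set of
points y has a common z with K(z, y) >= b; it is positive. Points that nearly
attain a on a suitable finite set are close to each other, because otherwise
their midpoint would do better than a. Hence these near-solutions form a Cauchy
filter. Its limit x satisfies K(x, y) >= a for all y and is the only such point
([optimal_cos]), so that x is the unique center and the radius is
acos a < pi / 2. *)

(** * Chains modulo 2 *)

(** Values of a cochain [f] on a chain modulo 2; chains are lists of ordered
simplices, and two lists are the same chain when all cochains agree on them. *)
Definition parity (T : Type) (f : T -> bool) (c : seq T) : bool :=
  \big[addb/false]_(s <- c) f s.

(** The augmented boundary: the empty simplex is the boundary of a vertex. *)
Fixpoint bd (V : eqType) (s : seq V) : seq (seq V) :=
  if s is v :: s' then s' :: map (cons v) (bd s') else [::].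

(** The triangulation of the homotopy from [a] to [b] over the simplex [s]: the
simplices a v_0, ..., a v_i, b v_i, ..., b v_k. *)
Fixpoint prism (V W : eqType) (a b : V -> W) (s : seq V) : seq (seq W) :=
  if s is v :: s' then (a v :: map b s) :: map (cons (a v)) (prism a b s')
  else [::].

Lemma parity_cons (T : Type) (f : T -> bool) s c :
  parity f (s :: c) = f s (+) parity f c.
Proof. by rewrite /parity big_cons. Qed.

Lemma parity_map (S T : Type) (h : S -> T) f c :
  parity f (map h c) = parity (f \o h) c.
Proof. by rewrite /parity big_map. Qed.

Lemma parity_flatten (S T : Type) (h : S -> seq T) f c :
  parity f (flatten (map h c)) = parity (fun s => parity f (h s)) c.
Proof. by rewrite /parity big_flatten big_map. Qed.

Lemma parityD (T : Type) (f g : T -> bool) c :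
  parity (fun s => f s (+) g s) c = parity f c (+) parity g c.
Proof. by rewrite /parity big_split. Qed.

Lemma eq_parity (T : Type) (f g : T -> bool) c :
  f =1 g -> parity f c = parity g c.
Proof. by move=> fg; apply: eq_bigr => s _; exact: fg. Qed.

Lemma parity0 (T : eqType) (f : T -> bool) c :
  {in c, forall s, f s = false} -> parity f c = false.
Proof. by move=> f0; rewrite /parity big1_seq// => s /andP[_ /f0]. Qed.

Lemma parity_bd_cons (V : eqType) (f : seq V -> bool) v s :
  parity f (bd (v :: s)) = f s (+) parity (fun t => f (v :: t)) (bd s).
Proof. by rewrite /= parity_cons parity_map. Qed.

Lemma parity_prism_cons (V W : eqType) (a b : V -> W) f v s :
  parity f (prism a b (v :: s)) =
  f (a v :: map b (v :: s)) (+) parity (fun t => f (a v :: t)) (prism a b s).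
Proof. by rewrite /= parity_cons parity_map. Qed.

Lemma parity_bd_map (V W : eqType) (b : V -> W) f s :
  parity (fun t => f (map b t)) (bd s) = parity f (bd (map b s)).
Proof.
elim: s f => [|v s IH] f; first by rewrite /= /parity !big_nil.
by rewrite map_cons !parity_bd_cons -(IH (fun t => f (b v :: t))).
Qed.

(** The chain homotopy formula: the boundary of a prism consists of its top, its
bottom and the prism over the boundary. Peeling off the first vertex makes all
the remaining terms cancel in pairs. *)
Lemma bd_prism (V W : eqType) (a b : V -> W) f s :
  parity (fun t => parity f (bd t)) (prism a b s) =
  f (map b s) (+) f (map a s) (+)
  parity (fun t => parity f (prism a b t)) (bd s).
Proof.
elim: s f => [|v s IH] f; first by rewrite /= /parity !big_nil addbF addbb.
rewrite parity_prism_cons parity_bd_cons.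
rewrite (eq_parity _ (fun t => parity_bd_cons f (a v) t)) parityD IH.
rewrite [in RHS]parity_bd_cons.
rewrite [in RHS](eq_parity _ (fun t => parity_prism_cons a b f v t)) parityD.
rewrite map_cons parity_bd_cons.
rewrite (parity_bd_map b (fun t => f [:: a v, b v & t])).
rewrite -![parity (fun t => f t) _]/(parity f _).
set A := f (b v :: _); set B := f (_ :: map b s).
set C := parity _ (bd (map b s)).
set D := parity _ (prism a b s).
set E := f _; set F := parity _ (bd s).
by case: A; case: B; case: C; case: D; case: E; case: F.
Qed.

(** * Sperner's lemma on a grid *)

Definition rainbow m (s : seq nat) := perm_eq s (iota 0 m.+1).

Lemma parity_count (T : Type) (a : pred T) c : parity a c = odd (count a c).
Proof.
elim: c => [|s c IH]; first by rewrite /parity big_nil.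
by rewrite parity_cons IH /= oddD oddb.
Qed.

(** Facets of [s] correspond to the entries removed from it, and the facet
without the entry [x] rearranges [t] exactly when [s] rearranges [x :: t]. *)
Lemma count_bd_perm (s t : seq nat) :
  count (perm_eq t) (bd s) = count (fun x => perm_eq (x :: t) s) s.
Proof.
have H u : count (fun r => perm_eq (u ++ r) t) (bd s) =
           count (fun x => perm_eq (x :: t) (u ++ s)) s.
  elim: s u => //= x s IH u.
  rewrite count_map; congr (nat_of_bool _ + _)%N.
    by rewrite [RHS]perm_sym -[x :: s]cat1s (perm_catCA u [:: x] s) perm_cons.
  rewrite -(eq_count (a1 := fun r => perm_eq (rcons u x ++ r) t)); last first.
    by move=> r /=; rewrite cat_rcons.
  by rewrite IH; apply: eq_count => y; rewrite cat_rcons.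
rewrite -(H [::]); apply: eq_count => r /=; exact: perm_sym.
Qed.

Lemma perm_iotaSr m : perm_eq (m :: iota 0 m) (iota 0 m.+1).
Proof. by rewrite -addn1 iotaD cats1 perm_sym perm_rcons. Qed.

(** The counting step of Sperner's lemma. If some facet carries exactly the
labels 0, ..., m, the entry removed from [s] is determined by [s]; it occurs
once in [s] when it is m + 1, and twice when it is one of 0, ..., m. *)
Lemma rainbow_bd m (s : seq nat) : all (leq^~ m.+1) s ->
  rainbow m.+1 s = parity (rainbow m) (bd s).
Proof.
move=> s_le; rewrite parity_count.
under eq_count => r do rewrite /rainbow perm_sym.
rewrite count_bd_perm.
have [/hasP[x xs Px]|/hasPn noP] :=
  boolP (has (fun x => perm_eq (x :: iota 0 m.+1) s) s); last first.
  rewrite (@eq_in_count _ _ pred0) ?count_pred0; last by move=> x /noP /negbTE.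
  apply/negP => H.
  have xs : m.+1 \in s by rewrite (perm_mem H) mem_iota add0n leqnn.
  move/negP: (noP _ xs); apply.
  by rewrite perm_sym (perm_trans H)// perm_sym perm_iotaSr.
rewrite (@eq_in_count _ _ (pred1 x)); last first.
  move=> y ys; apply/idP/eqP => [Py|->//].
  have : perm_eq (y :: iota 0 m.+1) (x :: iota 0 m.+1).
    by rewrite (perm_trans Py)// perm_sym.
  move/permP => /(_ (pred1 x)) /=; rewrite eqxx; case: (y =P x) => //= _.
  by move=> /eqP; rewrite -[X in X == _]add0n eqn_add2r.
rewrite -(permP Px (pred1 x)) -cat1s count_cat (count_uniq_mem _ (iota_uniq _ _)).
rewrite mem_iota /= eqxx addn0 add0n oddS oddb -leqNgt.
have := allP s_le _ xs; rewrite leq_eqVlt => /orP[/eqP xE|]; last first.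
  rewrite ltnS => xm; rewrite leqNgt ltnS xm; apply/negP => H.
  have /perm_mem/(_ m.+1) : perm_eq (x :: iota 0 m.+1) (iota 0 m.+2).
    by rewrite (perm_trans Px).
  by rewrite in_cons !mem_iota; lia.
by rewrite xE leqnn /rainbow perm_sym (perm_trans _ Px)// xE perm_sym perm_iotaSr.
Qed.

Lemma mem_prism (V W : eqType) (a b : V -> W) s t w :
  t \in prism a b s -> w \in t ->
  exists2 v, v \in s & w = a v \/ w = b v.
Proof.
elim: s t w => //= v s IH t w; rewrite inE => /orP[/eqP->|].
  rewrite !inE => /orP[/eqP->|/orP[/eqP->|/mapP[u us ->]]].
  - by exists v; [rewrite mem_head|left].
  - by exists v; [rewrite mem_head|right].
  - by exists u; [rewrite inE us orbT|right].
move=> /mapP[u us ->]; rewrite inE => /orP[/eqP->|/(IH _ _ us)[x xs xE]].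
  by exists v; [rewrite mem_head|left].
by exists x; [rewrite inE xs orbT|].
Qed.

Definition grid N m : pred (seq nat) :=
  [pred v | (size v == m) && all (leq^~ N) v].

Lemma grid_rcons N m v i : i <= N -> grid N m v -> grid N m.+1 (rcons v i).
Proof.
by move=> iN /andP[/eqP sv av]; apply/andP; rewrite size_rcons sv eqxx all_rcons iN.
Qed.

(** The fundamental chain of the grid {0, ..., N}^m, obtained from the one in
dimension m - 1 as the sum of the prisms over the N layers of the last
coordinate. *)
Fixpoint grid_chain N m : seq (seq (seq nat)) :=
  if m is m'.+1 then
    flatten [seq flatten [seq prism (rcons^~ i) (rcons^~ i.+1) s
                         | s <- grid_chain N m'] | i <- iota 0 N]
  else [:: [:: [::]]].

Lemma grid_chainS N m t : t \in grid_chain N m.+1 ->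
  exists i s, [/\ i < N, s \in grid_chain N m
    & t \in prism (rcons^~ i) (rcons^~ i.+1) s].
Proof.
move=> /flatten_mapP[i]; rewrite mem_iota add0n => /andP[_ iN].
by move=> /flatten_mapP[s sc ts]; exists i, s.
Qed.

Lemma grid_chain_grid N m s v : s \in grid_chain N m -> v \in s -> grid N m v.
Proof.
elim: m s v => [|m IH] s v; first by rewrite !inE => /eqP->; rewrite inE => /eqP->.
move=> /grid_chainS[i [u [iN uc su]]] /(mem_prism su)[x xu [->|->]];
  by apply: grid_rcons; [lia | exact: IH uc xu].
Qed.

Lemma grid_chain_adjacent N m s v w j : s \in grid_chain N m ->
  v \in s -> w \in s -> nth 0 v j <= (nth 0 w j).+1.
Proof.
elim: m s v w => [|m IH] s v w.
  by rewrite !inE => /eqP->; rewrite !inE => /eqP-> /eqP ->.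
move=> /grid_chainS[i [u [iN uc su]]].
move=> /(mem_prism su)[x xu xE] /(mem_prism su)[y yu yE].
have /andP[/eqP sx _] := grid_chain_grid uc xu.
have /andP[/eqP sy _] := grid_chain_grid uc yu.
have := IH _ _ _ uc xu yu.
by case: xE => ->; case: yE => ->; rewrite !nth_rcons sx sy;
  case: (ltngtP j m) => //; lia.
Qed.

(** The facets where a coordinate is 0, and those where one of the first [k]
coordinates is N. For [k] equal to [m] these are all the facets of the grid; for
[k] equal to [m.-1] the top facet is left out, and a Sperner labelling has no
simplex with labels 0, ..., m - 1 on any of the others. *)
Definition on_facet N m k (s : seq (seq nat)) :=
  {in s, forall v, grid N m v} /\
  exists j, (j < m /\ {in s, forall v, nth 0 v j = 0}) \/
            (j < k /\ {in s, forall v, nth 0 v j = N}).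

(** Prisms extend facets vertically, so the top facet of dimension m becomes a
side facet in dimension m + 1; this is why the premise allows all of them. *)
Lemma on_facet_prism N m i s t : i < N -> on_facet N m m s ->
  t \in prism (rcons^~ i) (rcons^~ i.+1) s -> on_facet N m.+1 m t.
Proof.
move=> iN [sg sj] ts; split=> [v /(mem_prism ts)[x xs [->|->]]|].
- by apply: grid_rcons; [lia | exact: sg].
- by apply: grid_rcons; [lia | exact: sg].
have nthE j v : j < m -> v \in t -> exists2 x, x \in s & nth 0 v j = nth 0 x j.
  move=> jm /(mem_prism ts)[x xs vE]; exists x => //.
  have /andP[/eqP sx _] := sg _ xs.
  by case: vE => ->; rewrite nth_rcons sx jm.
case: sj => j [[jm sj]|[jm sj]]; exists j; [left|right]; split; try lia.
- by move=> v /nthE -/(_ _ jm)[x xs ->]; exact: sj.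
- by move=> v /nthE -/(_ _ jm)[x xs ->]; exact: sj.
Qed.

Lemma parity_telescope (A : nat -> bool) N :
  parity (fun i => A i.+1 (+) A i) (iota 0 N) = A N (+) A 0.
Proof.
rewrite /parity; elim: N => [|N IH]; first by rewrite big_nil addbb.
rewrite -[in LHS]addn1 iotaD big_cat big_seq1 /= IH add0n.
by case: (A N.+1); case: (A N); case: (A 0).
Qed.

Lemma bd_grid_chainS N m f :
  parity (fun s => parity f (bd s)) (grid_chain N m.+1) =
  parity (fun s => f (map (rcons^~ N) s)) (grid_chain N m) (+)
  parity (fun s => f (map (rcons^~ 0) s)) (grid_chain N m) (+)
  parity (fun i => parity (fun s => parity (fun t =>
    parity f (prism (rcons^~ i) (rcons^~ i.+1) t)) (bd s)) (grid_chain N m))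
    (iota 0 N).
Proof.
rewrite [LHS]parity_flatten -(parity_telescope (fun i =>
  parity (fun s => f (map (rcons^~ i) s)) (grid_chain N m))) -parityD.
apply: eq_parity => i; rewrite [LHS]parity_flatten -!parityD.
by apply: eq_parity => s; rewrite bd_prism.
Qed.

Lemma on_facet_rcons N m k i s : i <= N -> s \in grid_chain N m ->
  i = 0 \/ i = N /\ m < k -> on_facet N m.+1 k (map (rcons^~ i) s).
Proof.
move=> iN sc ik; split=> [_ /mapP[v vs ->]|].
  exact/grid_rcons/(grid_chain_grid sc vs).
have nthm v : v \in map (rcons^~ i) s -> nth 0 v m = i.
  move=> /mapP[w ws ->]; have /andP[/eqP <- _] := grid_chain_grid sc ws.
  by rewrite nth_rcons ltnn eqxx.
exists m; case: ik => [i0|[iN' mk]]; [left|right]; split=> // v /nthm ->//.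
Qed.

(** A cochain that vanishes on the facets of [on_facet] sees only the top of
the grid: the bottom is one of these facets, and so is the prism over the
boundary of the grid of lower dimension. *)
Lemma bd_grid_chain N m f : (forall s, on_facet N m.+1 m s -> f s = false) ->
  parity (fun s => parity f (bd s)) (grid_chain N m.+1) =
  parity (fun s => f (map (rcons^~ N) s)) (grid_chain N m).
Proof.
elim: m f => [|m IH] f f0; rewrite bd_grid_chainS.
  rewrite [X in _ (+) X (+) _]parity0 => [|s sc]; last first.
    by apply: f0; apply: on_facet_rcons => //; left.
  rewrite addbF [X in _ (+) X]parity0 ?addbF// => i _.
  by rewrite /= /parity big_seq1 /= big_seq1 /= big_nil.
rewrite [X in _ (+) X (+) _]parity0 => [|s sc]; last first.
  by apply: f0; apply: on_facet_rcons => //; left.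
rewrite addbF [X in _ (+) X]parity0 ?addbF// => i.
rewrite mem_iota add0n => /andP[_ iN].
rewrite IH => [|s [sg [j sj]]].
  apply: parity0 => s sc; apply: parity0 => t ts; apply/f0/(on_facet_prism iN _ ts).
  by apply: on_facet_rcons => //; right.
apply: parity0 => t ts; apply/f0/(on_facet_prism iN _ ts).
split=> //; exists j; case: sj => [|[jm sj]]; [by left|right]; split=> //.
exact: ltnW.
Qed.

(** The number of cells with all labels 0, ..., m is odd. By [rainbow_bd] it has
the parity of the number of boundary facets labelled 0, ..., m - 1. Those all
lie in the top facet, where label m does not occur, so the induction hypothesis
applies there. *)
Lemma parity_rainbow N m (l : seq nat -> nat) :
  (forall v, grid N m v -> l v <= m) ->
  (forall v j, grid N m v -> j < m -> nth 0 v j = 0 -> j < l v) ->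
  (forall v j, grid N m v -> j < m -> nth 0 v j = N -> l v != j.+1) ->
  parity (fun s => rainbow m (map l s)) (grid_chain N m).
Proof.
elim: m l => [|m IH] l l_le l0 lN.
  rewrite /parity big_seq1 /= /rainbow /=.
  by have := l_le [::] isT; rewrite leqn0 => /eqP ->.
rewrite (_ : parity _ _ =
    parity (fun s => parity (fun t => rainbow m (map l t)) (bd s))
      (grid_chain N m.+1)); last first.
  apply: eq_big_seq => s sc; rewrite (parity_bd_map l) -rainbow_bd//.
  by apply/allP => _ /mapP[v vs ->]; apply/l_le/(grid_chain_grid sc vs).
rewrite bd_grid_chain => [|s [sg [j sj]]].
  under eq_parity => s do rewrite -map_comp.
  apply: IH => [v vg|v j vg jm vj|v j vg jm vj] /=.
  - have vNg := grid_rcons (leqnn N) vg.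
    rewrite -ltnS ltn_neqAle l_le// lN//.
    by have /andP[/eqP <- _] := vg; rewrite nth_rcons ltnn eqxx.
  - apply: l0; [exact: grid_rcons|exact: leqW|].
    by have /andP[/eqP sv _] := vg; rewrite nth_rcons sv jm.
  - apply: lN; [exact: grid_rcons|exact: leqW|].
    by have /andP[/eqP sv _] := vg; rewrite nth_rcons sv jm.
apply/negP => /perm_mem ls.
case: sj => [[jm sj]|[jm sj]].
- have : 0 \in map l s by rewrite ls mem_iota.
  by move=> /mapP[v vs l0v]; have := l0 v j (sg _ vs) jm (sj _ vs); rewrite -l0v.
- have : j.+1 \in map l s by rewrite ls mem_iota add0n ltnS.
  move=> /mapP[v vs lv]; have := lN v j (sg _ vs) (leqW jm) (sj _ vs).
  by rewrite -lv eqxx.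
Qed.

(** Labels of a grid point [v] avoid [j.+1] where coordinate [j] is maximal, and
exceed [j] where coordinate [j] vanishes. These are the boundary conditions of a
simplex with vertices 0, ..., m seen in the cube that parametrizes it by
iterated cones: maximal coordinates give the facets of the simplex, and where
coordinate [j] vanishes the cube is collapsed onto the face j + 1, ..., m. *)
Lemma sperner N m (l : seq nat -> nat) :
  (forall v, grid N m v -> l v <= m) ->
  (forall v j, grid N m v -> j < m -> nth 0 v j = 0 -> j < l v) ->
  (forall v j, grid N m v -> j < m -> nth 0 v j = N -> l v != j.+1) ->
  exists s, [/\ {in s, forall v, grid N m v},
    {in s &, forall v w j, nth 0 v j <= (nth 0 w j).+1} &
    forall k, k <= m -> k \in map l s].
Proof.
move=> l_le l0 lN.
have := parity_rainbow l_le l0 lN; rewrite parity_count => odd_r.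
have /hasP[s sc rs] : has (fun s => rainbow m (map l s)) (grid_chain N m).
  by rewrite has_count; case: count odd_r.
exists s; split=> [v|v w vs ws j|k km].
- exact: grid_chain_grid.
- exact: grid_chain_adjacent sc vs ws.
- by rewrite (perm_mem rs) mem_iota add0n ltnS.
Qed.

Import Order.TTheory GRing.Theory Num.Theory.

Local Open Scope classical_set_scope.
Local Open Scope ring_scope.

Import numFieldNormedType.Exports.

(** * The unit sphere *)

Lemma dotmul3E (R : realType) (u v : 'rV[R]_3) :
  dotmul3 u v = \sum_(i < 3) u 0 i * v 0 i.
Proof. by rewrite /dotmul3 mxE; apply: eq_bigr => i _; rewrite mxE. Qed.

Lemma dotmul3C (R : realType) (u v : 'rV[R]_3) : dotmul3 u v = dotmul3 v u.
Proof. by rewrite !dotmul3E; apply: eq_bigr => i _; rewrite mulrC. Qed.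

Lemma dotmul3_comb (R : realType) (a b : R) (u v w : 'rV[R]_3) :
  dotmul3 (a *: u + b *: v) w = a * dotmul3 u w + b * dotmul3 v w.
Proof. by rewrite /dotmul3 mulmxDl -!scalemxAl !mxE. Qed.

Lemma dotmul3_eq0 (R : realType) (u : 'rV[R]_3) : dotmul3 u u = 0 -> u = 0.
Proof.
rewrite dotmul3E => /psumr_eq0P u0; apply/rowP => i; rewrite mxE.
by apply/eqP; rewrite -sqrf_eq0 expr2 u0// => j _; rewrite -expr2 sqr_ge0.
Qed.

Definition point3 (R : realType) (a b c : R) : 'rV[R]_3 :=
  \row_(i < 3) [:: a; b; c]`_i.

Lemma dot_point3 (R : realType) (a b c a' b' c' : R) :
  dotmul3 (point3 a b c) (point3 a' b' c') = a * a' + b * b' + c * c'.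
Proof. by rewrite dotmul3E !big_ord_recl big_ord0 !mxE /= addr0 addrA. Qed.

Lemma sphereP (R : realType) (u : sphere2 R) : dotmul3 (val u) (val u) = 1.
Proof. exact/eqP/(svalP u). Qed.

Lemma acos_cos_dist (R : realType) (s t l : R) : l <= pi ->
  0 <= s <= l -> 0 <= t <= l -> acos (cos (s - t)) = `|s - t|.
Proof.
move=> lpi /andP[s0 sl] /andP[t0 tl].
rewrite -cos_norm cosK// in_itv /= normr_ge0/= ler_norml; lra.
Qed.

Lemma sphere_dist_itv (R : realType) (u v : sphere2 R) :
  0 <= dotmul3 (val u) (val v) ->
  [/\ 0 <= sphere_dist u v, sphere_dist u v < pi &
      cos (sphere_dist u v) = dotmul3 (val u) (val v)].
Proof.
move=> uv0; have uv1 : dotmul3 (val u) (val v) <= 1.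
  have : 0 <= dotmul3 (1 *: val u + (- 1) *: val v) (1 *: val u + (- 1) *: val v).
    by rewrite dotmul3E sumr_ge0// => i _; rewrite -expr2 sqr_ge0.
  rewrite dotmul3_comb [dotmul3 (val u) _]dotmul3C [dotmul3 (val v) _]dotmul3C.
  by rewrite !dotmul3_comb !sphereP [dotmul3 (val v) _]dotmul3C; lra.
rewrite /sphere_dist acosK ?in_itv/=; last lra.
by split => //; [apply: acos_ge0|apply: acos_ltpi]; lra.
Qed.

(** The arc from [u] to [v] is (sin (l - s) u + sin s v) / sin l. This gives the
scalar products of its points with any vector [w]; the formula is stated with
the denominator cleared so that it also covers the case [u = v]. *)
Lemma sphere_geodesic (R : realType) (u v : sphere2 R) :
  0 <= dotmul3 (val u) (val v) ->
  exists2 c : R -> sphere2 R, minimizing_geodesic (@sphere_dist R) u v c &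
    forall (w : 'rV[R]_3) (s : R),
      sin (sphere_dist u v) * dotmul3 (val (c s)) w =
      sin (sphere_dist u v - s) * dotmul3 (val u) w + sin s * dotmul3 (val v) w.
Proof.
move=> uv0; have [l0 lpi lE] := sphere_dist_itv uv0.
set l := sphere_dist u v in l0 lpi lE *.
have [lp|] := ltP 0 l; last first.
  move=> lle; have {l0 lle}l0 : l = 0 by lra.
  have uv : u = v.
    rewrite l0 cos0 in lE; apply/val_inj/eqP; rewrite -subr_eq0.
    apply/eqP/dotmul3_eq0.
    rewrite -[val u - val v](_ : 1 *: val u + (- 1) *: val v = _); last first.
      by rewrite scale1r scaleN1r.
    rewrite dotmul3_comb [dotmul3 (val u) _]dotmul3C [dotmul3 (val v) _]dotmul3C.
    by rewrite !dotmul3_comb !sphereP [dotmul3 (val v) _]dotmul3C -lE; lra.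
  exists (fun=> u).
    split=> // s t; rewrite -/l l0 => s0 t0.
    rewrite /sphere_dist sphereP acos1; have -> : s - t = 0 by lra.
    by rewrite normr0.
  by move=> w s; rewrite l0 sin0 -uv sub0r sinN; lra.
have sl : 0 < sin l by apply: sin_gt0_pi; rewrite lp lpi.
pose cv s := (sin (l - s) / sin l) *: val u + (sin s / sin l) *: val v.
have cvE w s : dotmul3 (cv s) w =
    (sin (l - s) * dotmul3 (val u) w + sin s * dotmul3 (val v) w) / sin l.
  by rewrite dotmul3_comb; field; lra.
have cvcv s t : dotmul3 (cv s) (cv t) = cos (s - t).
  rewrite cvE ![dotmul3 (val _) (cv _)]dotmul3C !cvE !sphereP.
  rewrite [dotmul3 (val v) _]dotmul3C -lE.
  apply: (mulIf (_ : sin l ^+ 2 != 0)); first by rewrite expf_neq0//; lra.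
  transitivity (sin (l - s) * sin (l - t) + sin s * sin t +
    (sin (l - s) * sin t + sin s * sin (l - t)) * cos l).
    by field; lra.
  rewrite !sinB cosB.
  have e2 : sin l ^+ 2 = 1 - cos l ^+ 2 := sin2cos2 l.
  ring: e2.
have cvP s : dotmul3 (cv s) (cv s) == 1 by rewrite cvcv subrr cos0.
exists (fun s => exist _ (cv s) (cvP s)).
  split; rewrite -/l.
  - apply/val_inj; rewrite /= /cv subr0 sin0 mul0r scale0r addr0 divff ?scale1r//.
    lra.
  - apply/val_inj; rewrite /= /cv subrr sin0 mul0r scale0r add0r divff ?scale1r//.
    lra.
  - move=> s t sl' tl; rewrite /sphere_dist /= cvcv.
    exact: (acos_cos_dist (ltW lpi) sl' tl).
by move=> w s; rewrite /= cvE; field; lra.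
Qed.

(** * Comparison inequalities for the cosine of the distance *)

Lemma ler_cos (R : realType) (x y : R) : 0 <= x -> x <= y -> y <= pi ->
  cos y <= cos x.
Proof.
move=> x0 xy ypi; have [->//|xy'] := eqVneq x y.
apply/ltW; rewrite ltr_cos ?in_itv/= ?lt_neqAle ?xy' ?xy//; lra.
Qed.

(** With the first side on the equator, the third vertex is determined by its
two scalar products up to reflection. It exists because the triangle inequality
bounds cos a between cos (l + b) and cos (l - b), which is what makes the square
of its last coordinate nonnegative. *)
Lemma comparison_triangle (R : realType) (l a b : R) :
  0 < l <= pi / 2 -> 0 <= a <= pi / 2 -> 0 <= b <= pi / 2 ->
  a <= l + b -> l <= a + b -> b <= l + a ->
  exists u v w : sphere2 R,
    [/\ dotmul3 (val u) (val v) = cos l, dotmul3 (val v) (val w) = cos a &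
        dotmul3 (val w) (val u) = cos b].
Proof.
move=> /andP[l0 l1] /andP[a0 a1] /andP[b0 b1] alb lab bla.
have pi0 := pi_gt0 R.
have sl : 0 < sin l by apply: sin_gt0_pi; lra.
have l2 : cos l ^+ 2 + sin l ^+ 2 = 1 := cos2Dsin2 l.
have b2 : cos b ^+ 2 + sin b ^+ 2 = 1 := cos2Dsin2 b.
pose e := (cos a - cos l * cos b) / sin l.
have eE : sin l * e = cos a - cos l * cos b by rewrite /e; field; lra.
have eb : 0 <= sin b ^+ 2 - e ^+ 2.
  have lo : cos (l + b) <= cos a by apply: ler_cos; lra.
  have hi : cos a <= cos (l - b).
    by rewrite -(cos_norm (l - b)); apply: ler_cos => //; rewrite ?ler_norml; lra.
  rewrite cosD in lo; rewrite cosB in hi.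
  rewrite subr_sqr -(pmulr_rge0 _ (exprn_gt0 2 sl)).
  rewrite [X in 0 <= X](_ : _ = (sin l * sin b - sin l * e) *
    (sin l * sin b + sin l * e)); last by ring.
  by rewrite eE mulr_ge0//; lra.
have w2 := sqr_sqrtr eb.
have uP : dotmul3 (point3 1 0 0) (point3 1 0 0) == 1 :> R.
  by rewrite dot_point3; apply/eqP; ring.
have vP : dotmul3 (point3 (cos l) (sin l) 0) (point3 (cos l) (sin l) 0) == 1.
  by rewrite dot_point3; apply/eqP; lra.
pose w := point3 (cos b) e (Num.sqrt (sin b ^+ 2 - e ^+ 2)).
have wP : dotmul3 w w == 1 by rewrite dot_point3; apply/eqP; lra.
pose on_sphere (z : 'rV[R]_3) zP : sphere2 R := exist _ z zP.
exists (on_sphere _ uP), (on_sphere _ vP), (on_sphere _ wP).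
by split; rewrite /= dot_point3; lra.
Qed.

(** Families indexed by the vertices, or by the sides, of a triangle. *)
Definition cyc3 (T : Type) (a b c : T) (i : 'I_3) : T := nth a [:: a; b; c] i.

Lemma cyc3_succ (T : Type) (a b c : T) i : cyc3 a b c (i + 1) = cyc3 b c a i.
Proof. by case: i => [[|[|[|]]]]. Qed.

Lemma geodesic_triangle_cyc3 (R : realType) (T : Type) (d : T -> T -> R)
    (x y z : T) c0 c1 c2 :
  minimizing_geodesic d x y c0 -> minimizing_geodesic d y z c1 ->
  minimizing_geodesic d z x c2 ->
  geodesic_triangle d (cyc3 x y z) (cyc3 c0 c1 c2).
Proof. by move=> g0 g1 g2 i; rewrite cyc3_succ; case: i => [[|[|[|]]]]. Qed.

(** In the comparison triangle this is an equality, by linearity of the scalar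
product with the vertex opposite to the geodesic; the CAT(1) inequality bounds
the distance in the space by the distance on the sphere. *)
Lemma CAT1_cos_convex (R : realType) (Y : metricType R)
    (Y_CAT1 : CAT1 Y) (Y_diam : forall x y : Y, mdist x y <= pi / 2)
    (p x y : Y) (c : R -> Y) (r : R) :
  minimizing_geodesic mdist p x c -> 0 <= r <= mdist p x ->
  sin (mdist p x - r) * cos (mdist p y) + sin r * cos (mdist x y) <=
  sin (mdist p x) * cos (mdist (c r) y).
Proof.
have pi0 := pi_gt0 R.
have [Y_geo Y_cmp] := Y_CAT1.
move=> cg /andP[r0 rl]; set l := mdist p x in rl *.
have [lp|] := ltP 0 l; last first.
  move=> l0; have r00 : r = 0 by lra.
  have -> : l = 0 by lra.
  by rewrite r00 subr0 sin0 !mul0r addr0.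
have [c1 c1g] : exists c, minimizing_geodesic mdist x y c.
  by apply: Y_geo; have := Y_diam x y; lra.
have [c2 c2g] : exists c, minimizing_geodesic mdist y p c.
  by apply: Y_geo; have := Y_diam y p; lra.
have cosd (z t : Y) : 0 <= cos (mdist z t).
  by apply: cos_ge0_pihalf; have := mdist_ge0 z t; have := Y_diam z t; lra.
have lpi : l <= pi / 2 by exact: Y_diam.
have Y_itv (z t : Y) : 0 <= mdist z t <= pi / 2 by rewrite mdist_ge0 Y_diam.
have yxE := metric_sym y x; have ypE := metric_sym y p; have xpE := metric_sym x p.
have [||||||u [v [w [uv vw wu]]]] :=
    @comparison_triangle R l (mdist x y) (mdist y p); rewrite ?lp ?Y_itv//=.
- by have := metric_triangle x p y; rewrite /l; lra.
- by have := metric_triangle p y x; rewrite /l; lra.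
- by have := metric_triangle y x p; rewrite /l; lra.
have distE (u' v' : sphere2 R) (z t : Y) :
    dotmul3 (val u') (val v') = cos (mdist z t) -> sphere_dist u' v' = mdist z t.
  move=> uvE; rewrite /sphere_dist uvE cosK// in_itv/= mdist_ge0/=.
  by have := Y_diam z t; lra.
have duv := distE _ _ _ _ uv; have dvw := distE _ _ _ _ vw.
have dwu := distE _ _ _ _ wu.
have uv0 : 0 <= dotmul3 (val u) (val v) by rewrite uv cosd.
have vw0 : 0 <= dotmul3 (val v) (val w) by rewrite vw cosd.
have wu0 : 0 <= dotmul3 (val w) (val u) by rewrite wu cosd.
have [c' c'g c'E] := sphere_geodesic uv0.
have [c1' c1'g _] := sphere_geodesic vw0.
have [c2' c2'g _] := sphere_geodesic wu0.
have {c'E} := c'E (val w) r; rewrite duv -/l.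
rewrite (dotmul3C (val u)) wu vw ypE => dE.
have sl : 0 < sin l by apply: sin_gt0_pi; lra.
have dge0 : 0 <= dotmul3 (val (c' r)) (val w).
  rewrite -(pmulr_rge0 _ sl) dE addr_ge0// mulr_ge0// ?cosd//.
    by apply: sin_ge0_pi; lra.
  by apply: sin_ge0_pi; lra.
have [_ dpi dcos] := sphere_dist_itv dge0.
rewrite -dE ler_pM2l// -dcos; apply: ler_cos (ltW dpi); first exact: mdist_ge0.
have -> : y = c2 0 by case: c2g.
have -> : w = c2' 0 by case: c2'g.
have := Y_cmp _ _ (geodesic_triangle_cyc3 cg c1g c2g) _ _ _
  (geodesic_triangle_cyc3 c'g c1'g c2'g) _ ord0 (@Ordinal 3 2 isT) r 0.
rewrite !cyc3_succ; apply.
- rewrite !big_ord_recl big_ord0 !cyc3_succ /= /cyc3 /=.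
  by have := Y_diam p x; have := Y_diam x y; have := Y_diam y p; lra.
- by move=> i; rewrite !cyc3_succ; case: i => [[|[|[|]]]].
- by rewrite /cyc3 /= r0.
- by rewrite /cyc3 /= lexx mdist_ge0.
Qed.

Lemma dist_minr (R : realDomainType) (a b c d e : R) :
  `|a - c| < e -> `|b - d| < e -> `|Num.min a b - Num.min c d| < e.
Proof.
rewrite !ltr_distl => /andP[? ?] /andP[? ?].
by case: (ltP a b) => ?; case: (ltP c d) => ?; apply/andP; split; lra.
Qed.

(** Applying [CAT1_cos_convex] along the first geodesic and then along the second
bounds the cosine on the right from below by its value for two geodesics lying
on one line, cos (r - r'), up to an error of at most 1 - cos (d(x, x')). The
parameters r and r' may differ, so that one estimate controls both variables of
a geodesic cone. *)
Lemma geodesic_fan_cos (R : realType) (Y : metricType R)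
    (Y_CAT1 : CAT1 Y) (Y_diam : forall x y : Y, mdist x y <= pi / 2)
    (p x x' : Y) (c c' : R -> Y) (r r' : R) :
  minimizing_geodesic mdist p x c -> minimizing_geodesic mdist p x' c' ->
  0 <= r <= mdist p x -> 0 <= r' <= mdist p x' ->
  cos (r - r') + cos (mdist x x') - 1 <= cos (mdist (c r) (c' r')).
Proof.
move=> cg c'g /andP[r0 rl] /andP[r'0 r'l].
have pi0 := pi_gt0 R.
have D1 := cos_le1 (mdist x x').
have [c0 cl cd] := cg; have [c'0 c'l c'd] := c'g.
have dp' : mdist p (c' r') = r'.
  by rewrite -c'0 c'd ?lexx ?mdist_ge0 ?r'0// sub0r normrN ger0_norm.
have dp : mdist (c r) p = r.
  by rewrite -{1}c0 cd ?lexx ?mdist_ge0 ?r0// subr0 ger0_norm.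
have [lp|l0] := ltP 0 (mdist p x); last first.
  have r00 : r = 0 by lra.
  by rewrite r00 c0 dp' sub0r cosN; lra.
have [l'p|l'0] := ltP 0 (mdist p x'); last first.
  have r'00 : r' = 0 by lra.
  by rewrite r'00 c'0 dp subr0; lra.
have lpi := Y_diam p x; have l'pi := Y_diam p x'.
have h1 := @CAT1_cos_convex _ _ Y_CAT1 Y_diam _ _ (c' r') _ r cg.
have h2 := @CAT1_cos_convex _ _ Y_CAT1 Y_diam _ _ x _ r' c'g.
rewrite r0 rl in h1; rewrite r'0 r'l in h2.
move: (h1 isT) (h2 isT); rewrite dp' [mdist x' x]metric_sym.
rewrite [mdist (c' r') x]metric_sym.
move: (mdist p x) (mdist p x') => l l' in cl c'l lp l'p lpi l'pi rl r'l *.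
have sl : 0 < sin l by apply: sin_gt0_pi; lra.
have sl' : 0 < sin l' by apply: sin_gt0_pi; lra.
have sr0 : 0 <= sin r by apply: sin_ge0_pi; lra.
have sr'0 : 0 <= sin r' by apply: sin_ge0_pi; lra.
have srl : sin r <= sin l.
  by rewrite -!cosBpihalf -![cos (_ - pi / 2)]cosN; apply: ler_cos; lra.
have srl' : sin r' <= sin l'.
  by rewrite -!cosBpihalf -![cos (_ - pi / 2)]cosN; apply: ler_cos; lra.
move: (cos (mdist x x')) D1 (cos (mdist x (c' r'))) (cos (mdist (c r) _)).
move=> D D1 X M hM hX.
rewrite -(ler_pM2l (mulr_gt0 sl sl')).
have := cos_le1 (l - l'); move: hM hX; rewrite !sinB !cosB.
move: (sin l) (sin l') (sin r) (sin r') sl sl' sr0 sr'0 srl srl'.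
move: (cos l) (cos l') (cos r) (cos r').
move=> C C' cr cr' S S' sr sr' S0 S'0 sr0 sr'0 srl srl'.
move=> hM hX hE.
have hM' := ler_wpM2l (ltW S'0) hM.
have hX' := ler_wpM2l sr0 hX.
(* The error is (sin r sin r') / (sin l sin l') times cos (l - l') - D; the
   first factor is at most 1, and the second at most 1 - D. *)
have h3 : sr * sr' <= S * S' by apply: ler_pM.
have h4 : 0 <= (1 - D) * (S * S' - sr * sr') by rewrite mulr_ge0//; lra.
have h5 : 0 <= (1 - (C * C' + S * S')) * (sr * sr').
  by rewrite mulr_ge0// ?mulr_ge0//; lra.
lra.
Qed.

(** From [CAT1_cos_convex] and sin l <= sin (l - r) + sin r. *)
Lemma geodesic_ball_convex (R : realType) (Y : metricType R)
    (Y_CAT1 : CAT1 Y) (Y_diam : forall x y : Y, mdist x y <= pi / 2)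
    (p x y : Y) (c : R -> Y) (r k : R) :
  minimizing_geodesic mdist p x c -> 0 <= r <= mdist p x ->
  0 <= k -> k <= cos (mdist p y) -> k <= cos (mdist x y) ->
  k <= cos (mdist (c r) y).
Proof.
move=> cg /andP[r0 rl] k0 kp kx; have pi0 := pi_gt0 R; have lpi := Y_diam p x.
have [lp|l0] := ltP 0 (mdist p x); last first.
  by have -> : r = 0; [lra|case: cg => ->].
have := @CAT1_cos_convex _ _ Y_CAT1 Y_diam _ _ y _ r cg; rewrite r0 rl => /(_ isT).
set l := mdist p x in lp rl lpi *; move=> h.
have sl : 0 < sin l by apply: sin_gt0_pi; lra.
have sr : 0 <= sin r by apply: sin_ge0_pi; lra.
have slr : 0 <= sin (l - r) by apply: sin_ge0_pi; lra.
have hp := ler_wpM2l slr kp; have hx := ler_wpM2l sr kx.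
have ssum : sin l <= sin (l - r) + sin r.
  rewrite -[X in sin X <= _](subrK r l) (sinD (l - r) r).
  by rewrite lerD// ?ler_piMr ?ler_piMl// cos_le1.
rewrite -(ler_pM2l sl); have := ler_wpM2r k0 ssum; lra.
Qed.

(** The factor cos (d(p, x) / 2), less than 1 for p <> x, is the strict convexity
that makes the center unique. *)
Lemma midpoint_cos (R : realType) (Y : metricType R)
    (Y_CAT1 : CAT1 Y) (Y_diam : forall x y : Y, mdist x y <= pi / 2) (p x : Y) :
  exists m, forall y, cos (mdist p y) + cos (mdist x y) <=
    2 * cos (mdist p x / 2) * cos (mdist m y).
Proof.
have pi0 := pi_gt0 R; have lpi := Y_diam p x.
have [c cg] : exists c, minimizing_geodesic mdist p x c by apply: Y_CAT1.1; lra.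
exists (c (mdist p x / 2)) => y.
have [lp|l0] := ltP 0 (mdist p x); last first.
  have l00 : mdist p x = 0 by have := mdist_ge0 p x; lra.
  rewrite l00 mul0r cos0 -(mdist_positivity _ _ l00).
  by case: cg => -> _ _; lra.
have := @CAT1_cos_convex _ _ Y_CAT1 Y_diam _ _ y _ (mdist p x / 2) cg.
set l := mdist p x in lp lpi *.
have -> : 0 <= l / 2 <= l by apply/andP; split; lra.
move=> /(_ isT); have -> : l - l / 2 = l / 2 by lra.
have -> : sin l = 2 * sin (l / 2) * cos (l / 2).
  have {1}-> : l = (l / 2) *+ 2 by rewrite mulr2n; lra.
  by rewrite sin_mulr2n mulr2n; ring.
have sl : 0 < sin (l / 2) by apply: sin_gt0_pi; lra.
by move=> h; rewrite -(ler_pM2l sl); lra.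
Qed.

(** * Geodesic cones *)

Definition geodesic_choice (R : realType) (Y : metricType R)
    (g : Y -> Y -> R -> Y) : Prop :=
  forall p x, minimizing_geodesic mdist p x (g p x).

Lemma geodesic_choice_exists (R : realType) (Y : metricType R)
    (Y_CAT1 : CAT1 Y) (Y_diam : forall x y : Y, mdist x y <= pi / 2) :
  exists g : Y -> Y -> R -> Y, geodesic_choice g.
Proof.
have pi0 := pi_gt0 R.
have ex p x : exists c, minimizing_geodesic (@mdist R Y) p x c.
  by apply: Y_CAT1.1; have := Y_diam p x; lra.
exists (fun p x => projT1 (cid (ex p x))) => p x.
exact: (projT2 (cid (ex p x))).
Qed.

(** Points of the cone are parametrized by their distance to the apex [p], which
is the parameter that [geodesic_fan_cos] controls. Cutting it off at the length
of the geodesic and taking absolute values makes the cone continuous in [t] on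
the whole real line. *)
Definition cone (R : realType) (Y : metricType R) (g : Y -> Y -> R -> Y)
    (p x : Y) (t : R) : Y := g p x (Num.min (mdist p x) `|t|).

Lemma cone_itv (R : realType) (Y : metricType R) (p x : Y) (t : R) :
  0 <= Num.min (mdist p x) `|t| <= mdist p x.
Proof. by rewrite le_min mdist_ge0 normr_ge0 ge_min lexx. Qed.

Lemma cone0 (R : realType) (Y : metricType R) (g : Y -> Y -> R -> Y)
    (p x : Y) :
  geodesic_choice g -> cone g p x 0 = p.
Proof.
by move=> /(_ p x)[g0 _ _]; rewrite /cone normr0 min_r ?mdist_ge0.
Qed.

Lemma cone_far (R : realType) (Y : metricType R) (g : Y -> Y -> R -> Y)
    (p x : Y) (t : R) :
  geodesic_choice g -> mdist p x <= t -> cone g p x t = x.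
Proof.
move=> /(_ p x)[_ gl _] lt; rewrite /cone min_l//.
by rewrite (le_trans lt)// ler_norm.
Qed.

(** For 2 e <= pi / 2, the only case with content, the cosine of the distance
exceeds 2 cos e - 1 by [geodesic_fan_cos], and cos (2 e) = 2 (cos e)^2 - 1 is not
larger. *)
Lemma cone_lipschitz (R : realType) (Y : metricType R)
    (Y_CAT1 : CAT1 Y) (Y_diam : forall x y : Y, mdist x y <= pi / 2)
    (g : Y -> Y -> R -> Y) (p x x' : Y) (t t' e : R) :
  geodesic_choice g -> mdist x x' < e -> `|t - t'| < e ->
  mdist (cone g p x t) (cone g p x' t') < 2 * e.
Proof.
move=> gP xx' tt'; have pi0 := pi_gt0 R.
set m := cone g p x t; set m' := cone g p x' t'.
rewrite ltNge; apply/negP => em.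
(* As all distances are at most pi / 2, this forces 2 * e <= pi / 2. *)
have mpi := Y_diam m m'; have x0 := mdist_ge0 x x'.
have := geodesic_fan_cos Y_CAT1 Y_diam (gP p x) (gP p x')
  (cone_itv p x t) (cone_itv p x' t').
rewrite -/(cone g p x t) -/(cone g p x' t') -/m -/m'.
set r := Num.min _ _; set r' := Num.min _ _; apply/negP; rewrite -ltNge.
have rr' : `|r - r'| < e.
  apply: dist_minr; last by rewrite (le_lt_trans _ tt')// ler_dist_dist.
  rewrite (le_lt_trans _ xx')// ler_norml.
  have := metric_triangle p x x'; have := metric_triangle p x' x.
  by rewrite [mdist x' x]metric_sym => ? ?; apply/andP; split; lra.
have ce : cos (mdist m m') <= cos (2 * e) by apply: ler_cos; lra.
have cr : cos e < cos (r - r').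
  by rewrite -(cos_norm (r - r')) ltr_cos// in_itv/= ?normr_ge0/=; lra.
have cx : cos e < cos (mdist x x').
  by rewrite ltr_cos// in_itv/= ?mdist_ge0/=; lra.
have ce0 : 0 <= cos e by apply: cos_ge0_pihalf; lra.
have c2e : cos (2 * e) = 2 * (cos e * cos e) - 1.
  by rewrite mulr_natl cos_mulr2n mulr2n expr2; ring.
have := ler_wpM2l ce0 (cos_le1 e); lra.
Qed.

(** * Simplices spanned by iterated cones *)

(** A map from the cube to the simplex spanned by P 0, ..., P m: coordinate
[t j] is the distance to the apex P (j + 1) of the last cone of the simplex on
P 0, ..., P (j + 1). *)
Fixpoint iter_cone (R : realType) (Y : metricType R) (g : Y -> Y -> R -> Y)
    (P : nat -> Y) (m : nat) (t : nat -> R) : Y :=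
  if m is m'.+1 then cone g (P m) (iter_cone g P m' t) (t m') else P 0%N.

Fixpoint iter_cone_range (R : realType) (Y : metricType R)
    (g : Y -> Y -> R -> Y) (P : nat -> Y) (m : nat) : set Y :=
  if m is m'.+1 then
    [set cone g (P m) xt.1 xt.2 | xt in iter_cone_range g P m' `*` `[0, pi / 2]]
  else [set P 0%N].

Definition cone_convex (R : realType) (Y : metricType R) (g : Y -> Y -> R -> Y)
    (C : set Y) := forall p x t, C p -> C x -> C (cone g p x t).

Lemma iter_cone_mem_range (R : realType) (Y : metricType R)
    (g : Y -> Y -> R -> Y) (P : nat -> Y) (m : nat) (t : nat -> R) :
  (forall j, (j < m)%N -> 0 <= t j <= pi / 2) ->
  iter_cone_range g P m (iter_cone g P m t).
Proof.
elim: m => [//|m IH] tm /=; exists (iter_cone g P m t, t m) => //; split => /=.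
  by apply: IH => j jm; apply/tm/ltnW.
by rewrite in_itv/= tm.
Qed.

Lemma iter_cone_convex (R : realType) (Y : metricType R) (g : Y -> Y -> R -> Y)
    (P : nat -> Y) (C : set Y) (m : nat) (t : nat -> R) :
  cone_convex g C -> (forall i, (i <= m)%N -> C (P i)) -> C (iter_cone g P m t).
Proof.
move=> gC; elim: m => [|m IH] PC /=; first exact: PC.
by apply: gC; [exact: PC|apply: IH => i im; exact/PC/leqW].
Qed.

(** At t j = pi / 2 the apex P (j + 1) has no influence, and the point lies in
the facet opposite to it. *)
Lemma iter_cone_far (R : realType) (Y : metricType R)
    (Y_diam : forall x y : Y, mdist x y <= pi / 2) (g : Y -> Y -> R -> Y)
    (P : nat -> Y) (C : set Y) (m j : nat) (t : nat -> R) :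
  geodesic_choice g -> cone_convex g C -> (j < m)%N -> t j = pi / 2 ->
  (forall i, (i <= m)%N -> i != j.+1 -> C (P i)) -> C (iter_cone g P m t).
Proof.
move=> gP gC; elim: m => [//|m IH].
rewrite ltnS leq_eqVlt => /predU1P[->|jm] tj PC /=.
  rewrite cone_far ?tj//; apply: iter_cone_convex => // i im.
  by apply: PC; [exact: leqW|lia].
apply: gC; first by apply: PC => //; lia.
by apply: IH => // i im; apply: PC; exact: leqW.
Qed.

(** At t j = 0 the point reached after j + 1 cones is the apex P (j + 1), so that
the earlier vertices are forgotten. *)
Lemma iter_cone_apex (R : realType) (Y : metricType R) (g : Y -> Y -> R -> Y)
    (P : nat -> Y) (C : set Y) (m j : nat) (t : nat -> R) :
  geodesic_choice g -> cone_convex g C -> (j < m)%N -> t j = 0 ->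
  (forall i, (i <= m)%N -> (j < i)%N -> C (P i)) -> C (iter_cone g P m t).
Proof.
move=> gP gC; elim: m => [//|m IH].
rewrite ltnS leq_eqVlt => /predU1P[->|jm] tj PC /=.
  by rewrite tj cone0//; apply: PC.
apply: gC; first by apply: PC => //; lia.
by apply: IH => // i im; apply: PC; exact: leqW.
Qed.

Lemma iter_cone_lipschitz (R : realType) (Y : metricType R)
    (Y_CAT1 : CAT1 Y) (Y_diam : forall x y : Y, mdist x y <= pi / 2)
    (g : Y -> Y -> R -> Y) (P : nat -> Y) (m : nat) (t t' : nat -> R) (e : R) :
  geodesic_choice g -> 0 < e -> (forall j, (j < m)%N -> `|t j - t' j| < e) ->
  mdist (iter_cone g P m t) (iter_cone g P m t') < 2 ^+ m * e.
Proof.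
move=> gP e0; elim: m => [|m IH] tt' /=; first by rewrite mdistxx expr0 mul1r.
rewrite exprS -mulrA; apply: cone_lipschitz => //.
  by apply: IH => j jm; exact/tt'/leqW.
rewrite (lt_le_trans (tt' _ (leqnn _)))// (ler_peMl (ltW e0))//.
by rewrite exprn_ege1// ler1n.
Qed.

Lemma continuous_cone (R : realType) (Y : metricType R)
    (Y_CAT1 : CAT1 Y) (Y_diam : forall x y : Y, mdist x y <= pi / 2)
    (g : Y -> Y -> R -> Y) (p : Y) : geodesic_choice g ->
  continuous (fun xt : Y * R => cone g p xt.1 xt.2).
Proof.
move=> gP [x t]; apply/metricType_numDomainType.cvgrPdist_lt => e e0.
have e20 : 0 < e / 2 by lra.
exists (ball x (e / 2), ball t (e / 2)); first by split; apply: nbhsx_ballx.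
move=> [y s] [/= xy ts]; rewrite [ltRHS](_ : _ = 2 * (e / 2)); last by lra.
by apply: cone_lipschitz => //; rewrite ballEmdist in xy.
Qed.

Lemma compact_iter_cone_range (R : realType) (Y : metricType R)
    (Y_CAT1 : CAT1 Y) (Y_diam : forall x y : Y, mdist x y <= pi / 2)
    (g : Y -> Y -> R -> Y) (P : nat -> Y) (m : nat) : geodesic_choice g ->
  compact (iter_cone_range g P m).
Proof.
move=> gP; elim: m => [|m IH] /=; first exact: compact_set1.
apply: continuous_compact; last first.
  by apply: compact_setX => //; exact: segment_compact.
exact/continuous_subspaceT/continuous_cone.
Qed.

(** * A Helly theorem *)

(** Every point of the compact set has this property with some [e], and the
property persists for nearby points and smaller [e]; the near-covering form of
compactness makes [e] uniform. *)
Lemma lebesgue_number (R : realType) (Y : metricType R) (K : set Y)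
    (V : set (set (set_type K))) : compact K -> open_cover V ->
  exists2 e : R, 0 < e &
    forall x, K x -> exists2 B, V B &
      forall y : set_type K, mdist x (set_val y) < e -> B y.
Proof.
move=> /compact_near_coveringP Kc [Vo VT].
pose small (e : R) (x : Y) := exists2 B, V B &
  forall y : set_type K, mdist x (set_val y) < e -> B y.
have /Kc : forall x, K x -> \forall x' \near x & e \near (0 : R)^'+, small e x'.
  move=> x Kx; have [B VB Bx] : (\bigcup_(B in V) B) (SigSub (mem_set Kx)).
    by rewrite VT.
  have [W Wo WB] := Vo _ VB.
  have : nbhs x W by apply: open_nbhs_nbhs; split => //; move: Bx; rewrite -WB.
  rewrite -metricType_numDomainType.nbhs_nbhs_mdist => -[d /= d0 dW].
  have d20 : 0 < d / 2 by lra.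
  exists (ball x (d / 2), [set e | e < d / 2]) => /=.
    by split; [exact: nbhsx_ballx|exact: nbhs_right_lt].
  move=> [x' e] [/= xx' ed]; exists B => // y x'y; rewrite -WB; apply: dW => /=.
  rewrite ballEmdist /= in xx'.
  by have := metric_triangle x x' (set_val y); lra.
move=> h; have [e [e0 sm]] : exists e : R, 0 < e /\ K `<=` small e.
  have : \forall e \near (0 : R)^'+, 0 < e /\ K `<=` small e.
    by near=> e; split; [near: e; exact: nbhs_right_gt|near: e; exact: h].
  by move=> /filter_ex.
by exists e.
Unshelve. all: by end_near. Qed.

(** If the sets had no common point, their complements would cover the compact
set spanned by the points [P i]. A grid point is labelled by an index [k] such
that [C k] misses a member of the refined cover that contains a whole ball
around the image of the grid point. The index is chosen as a function of the
member, so that the m + 1 labels found by [sperner] come from distinct members,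
all of them containing one point. *)
Lemma topological_helly (R : realType) (Y : metricType R)
    (Y_CAT1 : CAT1 Y) (Y_diam : forall x y : Y, mdist x y <= pi / 2)
    (g : Y -> Y -> R -> Y) (n m : nat) (C : nat -> set Y) (P : nat -> Y) :
  geodesic_choice g ->
  (forall K : set Y, compact K -> refinement_order_le (set_type K) n) ->
  (forall j, closed (C j)) -> (forall j, cone_convex g (C j)) ->
  (forall i j, (i <= m)%N -> (j <= m)%N -> i != j -> C j (P i)) ->
  (n <= m)%N -> exists z, forall j, (j <= m)%N -> C j z.
Proof.
move=> gP Y_dim Ccl Cg CP nm; apply: contrapT => noz.
have pi0 := pi_gt0 R.
pose K := iter_cone_range g P m.
have Kc : compact K by exact: compact_iter_cone_range.
pose U k : set (set_type K) := [set x | ~ C k (set_val x)].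
have Ucov : open_cover [set U k | k in [set k | (k <= m)%N]].
  split=> [_ [k _ <-]|].
    by exists (~` C k) => //; exact: closed_openC.
  apply/seteqP; split=> // x _; apply: contrapT => xU; apply: noz.
  exists (set_val x) => j jm; apply: contrapT => Cj; apply: xU.
  by exists (U j) => //; exists j.
have [V [Vcov VU Vn]] := Y_dim K Kc _ Ucov.
have [e e0 Ve] := lebesgue_number Kc Vcov.
have /choice[kap kapP] : forall B, exists k,
    V B -> (k <= m)%N /\ B `<=` U k.
  move=> B; have [VB|nVB] := pselect (V B); last by exists 0%N.
  by have [_ [k km <-] BU] := VU B VB; exists k.
(* Neighbouring grid points differ by at most (pi / 2) / N in each coordinate;
   for this N their images are at distance less than e. *)
pose N := (Num.truncn (pi / 2 * 2 ^+ m / e)).+1.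
have Ngt : pi / 2 * 2 ^+ m / e < N%:R by exact: truncnS_gt.
pose tau (v : seq nat) j : R := pi / 2 * (nth 0%N v j)%:R / N%:R.
have N0 : 0 < N%:R :> R by rewrite ltr0n.
have tauP v j : (j < m)%N -> grid N m v -> 0 <= tau v j <= pi / 2.
  move=> jm /andP[/eqP sv /allP vN].
  have : (nth 0%N v j)%:R <= N%:R :> R by rewrite ler_nat vN// mem_nth// sv.
  move=> vjN; rewrite /tau; apply/andP; split.
    by rewrite !mulr_ge0// ?invr_ge0; lra.
  by rewrite -mulrA ler_piMr ?ler_pdivrMr ?mul1r//; lra.
pose x v := iter_cone g P m (tau v).
have Kx v : grid N m v -> K (x v).
  by move=> vg; apply: iter_cone_mem_range => j jm; exact: tauP.
have /choice[B BP] : forall v, exists B : set (set_type K), grid N m v ->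
    V B /\ forall y : set_type K, mdist (x v) (set_val y) < e -> B y.
  move=> v.
  have [vg|] := boolP (grid N m v); last by exists set0.
  by have [B VB By] := Ve _ (Kx v vg); exists B.
have notC v : grid N m v -> ~ C (kap (B v)) (x v).
  move=> vg; have [VB By] := BP v vg; have [_ BU] := kapP _ VB.
  by apply: (BU (SigSub (mem_set (Kx v vg)))); apply: By; rewrite /= mdistxx.
have [||| s [sg sadj sk]] := @sperner N m (fun v => kap (B v)).
- by move=> v vg; have [VB _] := BP v vg; have [] := kapP _ VB.
- move=> v j vg jm vj; rewrite ltnNge; apply/negP => kj; apply: (notC v vg).
  apply: (iter_cone_apex gP (Cg _) jm); first by rewrite /tau vj mulr0 mul0r.
  by move=> i im ji; apply: CP => //; lia.
- move=> v j vg jm vj; apply/eqP => kj; apply: (notC v vg); rewrite kj.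
  apply: (iter_cone_far Y_diam gP (Cg _) jm).
    by rewrite /tau vj mulfK// gt_eqF.
  by move=> i im ij; apply: CP.
have close v w : v \in s -> w \in s -> mdist (x v) (x w) < e.
  move=> vs ws; have -> : e = 2 ^+ m * (e / 2 ^+ m).
    by rewrite mulrCA divff ?mulr1// expf_neq0.
  apply: iter_cone_lipschitz => // [|j jm]; first by rewrite divr_gt0 ?exprn_gt0.
  rewrite ltr_pdivlMr ?exprn_gt0// /tau -mulrBl -mulrBr normrM normrM.
  rewrite [`|_^-1|]gtr0_norm ?invr_gt0// [`|pi / 2|]gtr0_norm ?divr_gt0//.
  have le1 : `|(nth 0%N v j)%:R - (nth 0%N w j)%:R| <= 1 :> R.
    rewrite ler_distl lerBlDr !natr1 !ler_nat.
    by rewrite !sadj.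
  move: Ngt; rewrite ltr_pdivrMr// => Ngt.
  rewrite [ltLHS](_ : _ = pi / 2 * 2 ^+ m *
    `|(nth 0%N v j)%:R - (nth 0%N w j)%:R| / N%:R); last by ring.
  rewrite ltr_pdivrMr// [e * _]mulrC (le_lt_trans _ Ngt)// ler_piMr//.
  by rewrite mulr_ge0 ?exprn_ge0 ?divr_ge0// ltW.
have vk k : (k <= m)%N -> exists2 v, v \in s & kap (B v) = k.
  by move=> /sk /mapP[v vs ->]; exists v.
(* The image of one vertex of the cell lies in members with all labels. *)
have [v0 v0s _] := vk 0%N (leq0n _).
pose y := SigSub (mem_set (Kx v0 (sg _ v0s))) : set_type K.
have /choice[Bk BkP] : forall k, exists B : set (set_type K), (k <= m)%N ->
    [/\ V B, B y & kap B = k].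
  move=> k.
  have [km|] := leqP k m; last by exists set0.
  have [v vs vkE] := vk k km; exists (B v) => _.
  have [VB By] := BP v (sg _ vs); split => //.
  by apply: By; exact: close.
have : (`I_m.+1 #<= `I_n)%card.
  have Bk_inj : {in `I_m.+1 &, injective Bk}.
    move=> i j; rewrite !inE /= => im jm ij.
    by have [_ _ <-] := BkP i im; have [_ _ <-] := BkP j jm; rewrite ij.
  have := inj_card_eq Bk_inj; rewrite card_eq_le => /andP[_ h].
  apply: card_le_trans h _; apply: card_le_trans (Vn y).
  by apply: subset_card_le => _ [k km <-]; have [] := BkP k km.
by rewrite card_le_II leqNgt ltnS nm.
Qed.

(** * Points that are not far from any point of a finite set *)

Lemma dist_continuous (R : realType) (Y : metricType R) (y : Y) :
  continuous (fun x => mdist x y : R).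
Proof.
move=> x; apply/cvgrPdist_lt => e e0.
near=> z; have xz : mdist x z < e.
  by near: z; apply/metricType_numDomainType.nbhs_mdistP; exists e.
rewrite (le_lt_trans _ xz)// ler_norml.
have := metric_triangle x z y; have := metric_triangle z x y.
by rewrite [mdist z x]metric_sym => ? ?; apply/andP; split; lra.
Unshelve. all: by end_near. Qed.

Lemma closed_cos_ball (R : realType) (Y : metricType R) (y : Y) (k : R) :
  closed [set x | k <= cos (mdist x y)].
Proof.
apply: (@closed_comp _ _ (fun x => cos (mdist x y)) [set t | k <= t]).
  move=> x _; apply: continuous_comp; first exact: dist_continuous.
  exact: continuous_cos.
exact: closed_ge.
Qed.

(** The midpoint of the next point and of a solution for the previous ones at
worst halves the bound. *)
Lemma few_points_cos (R : realType) (Y : metricType R)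
    (Y_CAT1 : CAT1 Y) (Y_diam : forall x y : Y, mdist x y <= pi / 2) (y0 : Y)
    (s : seq Y) :
  exists z, forall y, y \in s -> 2 ^- size s <= cos (mdist z y).
Proof.
have cosd (z t : Y) : 0 <= cos (mdist z t).
  apply: cos_ge0_pihalf; have := mdist_ge0 z t; have := Y_diam z t.
  by have := pi_gt0 R; lra.
elim: s => [|y s [z zs]]; first by exists y0.
have [m mP] := midpoint_cos Y_CAT1 Y_diam z y; exists m => w ws.
have := mP w; have h : cos (mdist z y / 2) * cos (mdist m w) <= cos (mdist m w).
  by rewrite ler_piMl// cos_le1.
have p0 : 0 < 2 ^- size s :> R by rewrite invr_gt0 exprn_gt0.
have p1 : 2 ^- size s <= 1 :> R.
  by rewrite invf_le1 ?exprn_gt0// exprn_ege1// ler1n.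
rewrite /= exprS invfM; move: ws h; rewrite inE => /predU1P[->|/zs zw] h.
  by rewrite mdistxx cos0; have := cosd z y; lra.
by have := cosd y w; lra.
Qed.

(** Induction on the number of points: up to [n] points are served by
[few_points_cos], and from then on the solutions for the families with one point
removed are the points required by [topological_helly]. *)
Lemma finite_helly_cos (R : realType) (Y : metricType R)
    (Y_CAT1 : CAT1 Y) (Y_diam : forall x y : Y, mdist x y <= pi / 2) (y0 : Y)
    (n : nat) (s : seq Y) :
  (forall K : set Y, compact K -> refinement_order_le (set_type K) n) ->
  exists z, forall y, y \in s -> 2 ^- n <= cos (mdist z y).
Proof.
move=> Y_dim; have [g gP] := geodesic_choice_exists Y_CAT1 Y_diam.
have [N] := ubnP (size s); elim: N s => // N IH s; rewrite ltnS => sN.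
have [sn|ns] := leqP (size s) n.
  have [z zP] := few_points_cos Y_CAT1 Y_diam y0 s; exists z => y ys.
  apply: le_trans (zP y ys).
  by rewrite lef_pV2 ?posrE ?exprn_gt0// ler_weXn2l// ler1n.
have p0 : 0 <= 2 ^- n :> R by rewrite invr_ge0 exprn_ge0.
have /choice[P PP] : forall i, exists z, (i < size s)%N ->
    forall j, (j < size s)%N -> i != j -> 2 ^- n <= cos (mdist z (nth y0 s j)).
  move=> i; have [si|is_] := leqP (size s) i; first by exists y0; lia.
  have [|z zP] := IH (take i s ++ drop i.+1 s).
    by rewrite size_cat size_take size_drop is_; lia.
  exists z => _ j js ij; apply: zP; rewrite mem_cat.
  have [ji|ij'] := ltnP j i.
    by rewrite -(nth_take y0 ji) mem_nth// size_take is_.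
  have {ij ij'}ij : (i < j)%N by lia.
  have -> : nth y0 s j = nth y0 (drop i.+1 s) (j - i.+1).
    by rewrite nth_drop subnKC.
  by rewrite mem_nth ?orbT// size_drop ltn_sub2r// (leq_ltn_trans ij js).
pose C j := [set z | 2 ^- n <= cos (mdist z (nth y0 s j))].
have [] := @topological_helly _ _ Y_CAT1 Y_diam g n (size s).-1 C P gP Y_dim.
- by move=> j; exact: closed_cos_ball.
- move=> j p x t Cp Cx.
  exact: (geodesic_ball_convex Y_CAT1 Y_diam (gP p x) (cone_itv p x t)).
- by move=> i j im jm ij; apply: PP => //; lia.
- by lia.
move=> z zC; exists z => y /(nthP y0)[j js <-]; apply: zC.
by rewrite -ltnS (ltn_predK js).
Qed.

(** * The center *)

(** The best constant [a] for finite sets is attained on the whole space, at a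
single point. If [z] and [z'] are solutions up to [e] on a finite set on which
a + e is not attainable, the midpoint inequality gives
a - e < cos (d(z, z') / 2) (a + e), and [z] and [z'] are close for small [e].
This yields both the limit point and its uniqueness. *)
Lemma optimal_cos (R : realType) (Y : metricType R)
    (Y_CAT1 : CAT1 Y) (Y_diam : forall x y : Y, mdist x y <= pi / 2)
    (Y_complete : complete_space Y) (y0 : Y) (k : R) :
  0 < k ->
  (forall s : seq Y, exists z, forall y, y \in s -> k <= cos (mdist z y)) ->
  exists a x, [/\ 0 < a <= 1, forall y : Y, a <= cos (mdist x y),
    forall b z, (forall y : Y, b <= cos (mdist z y)) -> b <= a &
    forall z, (forall y : Y, a <= cos (mdist z y)) -> z = x].
Proof.
move=> k0 kP; have pi0 := pi_gt0 R.
pose A := [set a : R | forall s : seq Y,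
  exists z, forall y, y \in s -> a <= cos (mdist z y)].
have A1 a : A a -> a <= 1.
  by move=> /(_ [:: y0])[z /(_ y0 (mem_head _ _))/le_trans]; apply; exact: cos_le1.
have Asup : has_sup A by split; [exists k | exists 1 => a /A1].
set a := sup A.
have aub b : A b -> b <= a by move=> Ab; exact: sup_upper_bound.
have a0 : 0 < a by rewrite (lt_le_trans k0)// aub.
have a1 : a <= 1 by apply: ge_sup; [exists k|move=> b /A1].
pose E (s : seq Y) (e : R) :=
  [set z | forall y, y \in s -> a - e <= cos (mdist z y)].
have E0 s e : 0 < e -> E s e !=set0.
  move=> e0; have [b Ab ba] := sup_adherent e0 Asup.
  by have [z zP] := Ab s; exists z => y ys; rewrite (le_trans (ltW ba))// zP.
have Esmall d : 0 < d -> exists s e, 0 < e /\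
    forall z z', E s e z -> E s e z' -> mdist z z' < d.
  move=> d0; pose c := cos (Num.min d (pi / 2) / 2).
  have dp : 0 < Num.min d (pi / 2) <= pi / 2.
    by rewrite lt_min ge_min lexx orbT d0 divr_gt0.
  have c0 : 0 <= c by apply: cos_ge0_pihalf; lra.
  have c1 : c < 1 by rewrite /c -[ltRHS](@cos0 R) ltr_cos ?in_itv/=; lra.
  (* Small enough for c * (a + e) < a - e. *)
  pose e := a * (1 - c) / 3.
  have e0 : 0 < e by rewrite /e divr_gt0 ?mulr_gt0//; lra.
  have [s sP] : exists s : seq Y, forall z,
      exists2 y, y \in s & cos (mdist z y) < a + e.
    apply: contrapT => ns; suff /aub : A (a + e) by lra.
    move=> s; apply: contrapT => nz; apply: ns; exists s => z.
    apply: contrapT => ny; apply: nz; exists z => y ys.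
    by rewrite leNgt; apply/negP => lt; apply: ny; exists y.
  exists s, e; split=> // z z' zE z'E.
  have [m mP] := midpoint_cos Y_CAT1 Y_diam z z'.
  have [y ys ym] := sP m; rewrite ltNge; apply/negP => dzz'.
  have czz' : cos (mdist z z' / 2) <= c.
    have := Y_diam z z'; have := mdist_ge0 z z'.
    have : Num.min d (pi / 2) <= mdist z z' by rewrite ge_min dzz'.
    by move=> ? ? ?; apply: ler_cos; lra.
  have := mP y; have := zE y ys; have := z'E y ys.
  have cm0 : 0 <= cos (mdist m y).
    by apply: cos_ge0_pihalf; have := mdist_ge0 m y; have := Y_diam m y; lra.
  have h1 := ler_wpM2r cm0 czz'; have h2 := ler_wpM2l c0 (ltW ym).
  have h3 : c * e <= e by rewrite ler_piMl// ltW.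
  rewrite /e in h2 h3 *; have h4 := mulr_gt0 a0 (_ : 0 < 1 - c); lra.
pose F := filter_from [set se : seq Y * R | 0 < se.2] (fun se => E se.1 se.2).
have FF : ProperFilter F.
  apply: filter_from_proper; last by move=> [s e] /= e0; exact: E0.
  apply: filter_from_filter; first by exists ([::], 1) => /=.
  move=> [s e] [s' e'] /= e0 e'0; exists (s ++ s', Num.min e e') => /=.
    by rewrite lt_min e0 e'0.
  move=> z /= zE; split=> y ys.
    apply: le_trans (zE y _); last by rewrite mem_cat ys.
    by rewrite lerB// ge_min lexx.
  apply: le_trans (zE y _); last by rewrite mem_cat ys orbT.
  by rewrite lerB// ge_min lexx orbT.
have [x Fx] : exists x : Y, F --> x.
  apply: Y_complete; apply: (@cauchy_exP R) => d d0.
  have [s [e [e0 sP]]] := Esmall d d0; have [z zE] := E0 s e e0.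
  by exists z; exists (s, e) => //= z' z'E; rewrite ballEmdist /=; exact: sP.
have xP y : a <= cos (mdist x y).
  apply/ler_addgt0Pr => e e0; rewrite -lerBlDr.
  apply: (closed_cos_ball (y := y) (k := a - e)) => B xB.
  have FE : F (E [:: y] e) by exists ([:: y], e).
  have [z [zE zB]] := filter_ex (filterI FE (Fx _ xB)).
  by exists z; split => //; apply: zE; rewrite mem_head.
exists a, x; split => //; first by rewrite a0 a1.
  by move=> b z zb; apply: aub => s; exists z => y _.
move=> z za; apply/mdist_positivity/le_anti; rewrite mdist_ge0 andbT.
apply/ler_addgt0Pr => d d0; rewrite add0r.
have [s [e [e0 sP]]] := Esmall d d0.
have Eall w : (forall y, a <= cos (mdist w y)) -> E s e w.
  by move=> wa y _; have := wa y; lra.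
by apply/ltW/sP; exact: Eall.
Qed.

(** A bound on the dimension of all compact subsets gives one order bound valid
for all of them, since refinements of smaller order may be kept. *)
Lemma dimC_finite (R : realType) (Y : metricType R) :
  (dimC R Y < +oo)%E -> exists n, forall K : set Y, compact K ->
    refinement_order_le (set_type K) n.
Proof.
move=> dimY; have [N dN] : exists N : nat, (dimC R Y < N%:R%:E)%E.
  case: (dimC R Y) dimY => [r _||] //; last by exists 0%N; rewrite ltNye.
  by exists (Num.truncn r).+1; rewrite lte_fin truncnS_gt.
exists N => K Kc; have : (covering_dim R (set_type K) < N%:R%:E)%E.
  by apply: le_lt_trans dN; apply: ereal_sup_ubound; exists K.
move=> /ereal_inf_lt[_ [n nP <-]]; rewrite lte_fin ltrBlDr natr1 ltr_nat ltnS => nN.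
move=> U /nP[V [Vc VU Vn]]; exists V; split => // x.
by apply: card_le_trans (Vn x) _; rewrite card_le_II.
Qed.

Theorem theorem1p7 (R : realType) (Y : metricType R)
    (Y_nonempty : [set: Y] !=set0)
    (Y_complete : complete_space Y)
    (Y_CAT1 : CAT1 Y)
    (Y_dimC : (dimC R Y < +oo)%E)
    (Y_diam : (diameter Y <= (pi / 2)%:E)%E) :
  (metric_radius Y < (pi / 2)%:E)%E /\ (exists x : Y, centers Y = [set x]).
Proof.
have pi0 := pi_gt0 R; have [y0 _] := Y_nonempty.
have diamY (x y : Y) : mdist x y <= pi / 2.
  rewrite -lee_fin; apply: le_trans Y_diam.
  by apply: ereal_sup_ubound; exists (x, y).
have [n Yn] := dimC_finite Y_dimC.
have [] := @optimal_cos _ _ Y_CAT1 diamY Y_complete y0 (2 ^- n).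
- by rewrite invr_gt0 exprn_gt0.
- by move=> s; exact: finite_helly_cos.
move=> a [x [/andP[a0 a1] xa amax auniq]].
have a_itv : a \in `[(-1), 1] by rewrite in_itv/=; lra.
have cosr := acosK a_itv; set r := acos a in cosr.
have r0 : 0 <= r by apply: acos_ge0; lra.
have rpi : r <= pi by apply: acos_lepi; lra.
have rlt : r < pi / 2.
  rewrite ltNge; apply/negP => pir.
  by have := ler_cos (_ : 0 <= pi / 2) pir rpi; rewrite cos_pihalf cosr; lra.
have le_r (z : Y) :
    (eccentricity z <= r%:E)%E -> forall y, a <= cos (mdist z y).
  move=> zr y; rewrite -cosr; apply: ler_cos => //; first exact: mdist_ge0.
  rewrite -lee_fin; apply: le_trans zr; apply: ereal_sup_ubound; by exists y.
have r_le (z : Y) : (r%:E <= eccentricity z)%E.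
  rewrite leNgt; apply/negP => zr.
  have z0 : (0%:E <= eccentricity z)%E.
    by apply: ereal_sup_ubound; exists z; rewrite ?mdistxx.
  have zub y : ((mdist z y)%:E <= eccentricity z)%E.
    by apply: ereal_sup_ubound; exists y.
  move: (eccentricity z) zr z0 zub => [e| |]//.
  rewrite lte_fin lee_fin => er e0 zub.
  have /(amax _ z) : forall y, cos e <= cos (mdist z y).
    move=> y; apply: ler_cos; [exact: mdist_ge0|by rewrite -lee_fin|lra].
  by rewrite -cosr leNgt ltr_cos ?er// in_itv/=; lra.
have ecc_x : eccentricity x = r%:E.
  apply/le_anti; rewrite r_le andbT; apply: ge_ereal_sup => _ [y _ <-].
  rewrite lee_fin leNgt; apply/negP => ry; have := xa y.
  rewrite -cosr leNgt ltr_cos ?ry// in_itv/= ?mdist_ge0/=; have := diamY x y; lra.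
have rad : metric_radius Y = r%:E.
  apply/le_anti/andP; split.
    by rewrite -ecc_x; apply: ereal_inf_lbound; exists x.
  by apply: le_ereal_inf_tmp => _ [z _ <-].
split; first by rewrite rad lte_fin.
exists x; apply/seteqP; split => z; rewrite /centers /= rad.
  by move=> zr; apply: auniq; apply: le_r; rewrite zr.
by move=> ->.
Qed.
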